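(* The following two sequences of polynomials satisfy the $q$-Gauss congruences. (1) For any integer $b \ge -1$, the sequence $d_n(q) = \sum_{i=0}^{\lfloor n/2 \rfloor} q^{i(i+b)} {n \brack i}_q {n-i \brack i}_q$, $n \ge 1$. (2) The sequence $e_n(q) = \mathrm{Tr}\big(A(q^{n-1})A(q^{n-2})\cdots A(q)A(1)\big)$, $n\ge 1$, where $A(x) = \begin{bmatrix} 1 & x \\ 1 & 0\end{bmatrix}$ is a $2\times 2$ matrix with entries in $\mathbb{Z}[x]$.
   Context: For a positive integer $n$, $[n]_q = \frac{q^n-1}{q-1} \in \mathbb{Z}[q]$, $[n]_q! = \prod_{i=1}^n [i]_q$, $[0]_q!=1$, and for $n \ge k \ge 0$ the $q$-binomial coefficient is ${n \brack k}_q = \frac{[n]_q!}{[k]_q![n-k]_q!} \in \mathbb{Z}[q]$. Let $\mu$ be the Möbius function. A sequence $\{a_n(q)\}_{n\ge 1} \subseteq \mathbb{Z}[q]$ satisfies the $q$-Gauss congruences if for every $n \ge 1$ the polynomial $\sum_{d \mid n} \mu(d)\, a_{n/d}(q^d)$ is divisible by $[n]_q$ in $\mathbb{Z}[q]$. *)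

(* Defs.v *)
From HB Require Import structures.
From mathcomp Require Import all_boot all_order all_algebra.
From mathcomp Require Import zify ring.
Set Implicit Arguments.
Unset Strict Implicit.
Unset Printing Implicit Defensive.
Import Order.TTheory GRing.Theory Num.Theory.
Local Open Scope ring_scope.

(* Z[q] is {poly int}, with 'X in the role of q.  MathComp's %/ on {poly int}
   is a pseudo-division; it is used below only with monic divisors, for which
   it is the genuine Euclidean division, and all these divisions are exact
   (qintM and qbinE). *)

Definition qint (n : nat) : {poly int} := ('X^n - 1) %/ ('X - 1).

Definition qfact (n : nat) : {poly int} := \prod_(1 <= i < n.+1) qint i.

(* Meaningful for k <= n only. *)
Definition qbin (n k : nat) : {poly int} :=
  qfact n %/ (qfact k * qfact (n - k)).

(* Meaningful for n > 0 only. *)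
Definition mobius (n : nat) : int :=
  if all (fun p => logn p n == 1%N) (primes n)
  then (-1) ^+ size (primes n) else 0.

(* MathComp's %| on {poly int} is divisibility up to a nonzero integer
   factor, hence the explicit quotient in Z[q]. *)
Definition poly_divides (p r : {poly int}) : Prop :=
  exists c : {poly int}, r = c * p.

(* Only the values of a at positive indices matter. *)
Definition q_Gauss (a : nat -> {poly int}) : Prop :=
  forall n : nat, (0 < n)%N ->
    poly_divides (qint n)
      (\sum_(d <- divisors n) mobius d *: (a (n %/ d)%N \Po 'X^d)).

(* For b >= -1 the exponent i * (i + b) is nonnegative (exponent_ge0), so the
   absolute value only converts it to nat. *)
Definition d_seq (b : int) (n : nat) : {poly int} :=
  \sum_(0 <= i < (n./2).+1)
    'X^(absz (i%:Z * (i%:Z + b))) * qbin n i * qbin (n - i) i.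

Definition A_mx (x : {poly int}) : 'M[{poly int}]_2 :=
  \matrix_(i < 2, j < 2)
    if i == 0 then (if j == 0 then 1 else x) else (if j == 0 then 1 else 0).

(* The i-th factor from the left is A(q^(n-1-i)). *)
Definition e_seq (n : nat) : {poly int} :=
  \tr (\prod_(0 <= i < n) A_mx 'X^(n.-1 - i)).

Lemma exponent_ge0 (b : int) (i : nat) : -1 <= b -> 0 <= i%:Z * (i%:Z + b).
Proof. by case: i => [|i] hb; [rewrite mul0r | apply: mulr_ge0; lia]. Qed.

Lemma qint_sum n : qint n = \sum_(i < n) 'X^i.
Proof.
rewrite /qint subrX1 mulrC Pdiv.IdomainMonic.mulpK //.
by rewrite -polyC1 monicXsubC.
Qed.

Lemma qintM n : qint n * ('X - 1) = 'X^n - 1.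
Proof. by rewrite qint_sum mulrC -subrX1. Qed.

Lemma qintD m n : qint (m + n) = qint m + 'X^m * qint n.
Proof.
rewrite !qint_sum big_split_ord /= mulr_sumr; congr (_ + _).
by apply: eq_bigr => i _; rewrite exprD.
Qed.

Lemma qint_monic n : qint n.+1 \is monic.
Proof.
have m1 : 'X - 1 \is @monic int by rewrite -polyC1 monicXsubC.
by rewrite -(monicMr _ m1) qintM -polyC1 monicXnsubC.
Qed.

Lemma qfactS n : qfact n.+1 = qfact n * qint n.+1.
Proof. by rewrite /qfact big_nat_recr. Qed.

Lemma qfact_monic n : qfact n \is monic.
Proof.
elim: n => [|n IHn]; first by rewrite /qfact big_nil monic1.
by rewrite qfactS monicMl // qint_monic.
Qed.

Lemma qfact_dvd m n : exists c : {poly int}, qfact (m + n) = c * (qfact m * qfact n).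
Proof.
elim: m n => [|m IHm] n.
  by exists 1; rewrite add0n {2}/qfact big_nil !mul1r.
elim: n => [|n [c Ec]].
  by exists 1; rewrite addn0 {3}/qfact big_nil mulr1 mul1r.
have [c' Ec'] := IHm n.+1.
exists (c' + 'X^(m.+1) * c).
rewrite addnS qfactS -addnS qintD mulrDr {1}addSnnS Ec' Ec !qfactS; ring.
Qed.

Lemma qbinE n k : (k <= n)%N -> qbin n k * (qfact k * qfact (n - k)) = qfact n.
Proof.
move=> le_kn; have [c] := qfact_dvd k (n - k); rewrite subnKC // /qbin => ->.
by rewrite Pdiv.IdomainMonic.mulpK // monicMl qfact_monic.
Qed.

(* Main.v *)
Require Import Defs.
From HB Require Import structures.
From mathcomp Require Import all_boot all_order all_algebra all_field.
From mathcomp Require Import zify ring.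
Set Implicit Arguments.
Unset Strict Implicit.
Unset Printing Implicit Defensive.
Import Order.TTheory GRing.Theory Num.Theory.
Local Open Scope ring_scope.

(* [n]_q is monic with simple roots, the n-th roots of unity other than 1, so
   divisibility by it is vanishing at these roots.  If a_(mN)(w) depends only
   on N whenever w is a primitive m-th root of unity, then at such a w the
   Gauss sum is a sum of mu(d) c(n / lcm(m, d)), in which the terms d and pd
   cancel for any prime p | m not dividing d.

   For d_n the value at w is given by the q-Lucas congruence, read off the
   q-binomial theorem and prod_(i < m) (X - w^i) = X^m - 1.  For e_n the
   product over mN factors is M^N with M = A(w^(m-1)) ... A(1), and det M = -1,
   tr M = 1 as for A(1).  The trace is found by inserting a variable x: the
   trace of A(w^(m-1) x) ... A(x) is invariant under x -> w x by cyclicity, and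
   its degree in x is less than m for m > 1, so it is its value at x = 0. *)

(** * Evaluation of integer polynomials at algebraic numbers *)

Definition ev (w : algC) : {poly int} -> algC := horner_eval w \o map_poly intr.
HB.instance Definition _ w := GRing.RMorphism.on (ev w).

Lemma evX w n : ev w 'X^n = w ^+ n.
Proof. by rewrite /ev /= map_polyXn /horner_eval hornerXn. Qed.

Lemma ev_comp w n p : ev w (p \Po 'X^n) = ev (w ^+ n) p.
Proof.
by rewrite /ev /= map_comp_poly /horner_eval horner_comp map_polyXn hornerXn.
Qed.

(** * Cancellation in Moebius sums *)

Lemma mobius_mul_prime p d : prime p -> (0 < d)%N -> ~~ (p %| d)%N ->
  mobius (p * d) = - mobius d.
Proof.
move=> p_pr d_gt0 pNd; have p_gt0 := prime_gt0 p_pr.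
have pNpr : p \notin primes d by rewrite mem_primes p_pr d_gt0.
have Ppd : perm_eq (primes (p * d)) (p :: primes d).
  apply: uniq_perm; rewrite /= ?primes_uniq ?pNpr //.
  by move=> r; rewrite primesM // primes_prime // !inE.
rewrite /mobius (perm_all _ Ppd) (perm_size Ppd) /=.
rewrite lognM // logn_prime // eqxx lognE (negPf pNd) !andbF addn0 eqxx /=.
rewrite (@eq_in_all _ _ (fun r => logn r d == 1%N)); last first.
  move=> r; rewrite mem_primes => /and3P[r_pr _ r_d].
  rewrite lognM // logn_prime // (_ : (r == p) = false) ?add0n //.
  by apply: contraNF pNd => /eqP<-.
by case: ifP; rewrite ?oppr0 // exprS mulN1r.
Qed.

Lemma mobius_sqr p d : prime p -> (0 < d)%N -> (p ^ 2 %| d)%N -> mobius d = 0.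
Proof.
move=> p_pr d_gt0 p2d; rewrite /mobius; case: ifP => // /allP/(_ p).
rewrite mem_primes p_pr d_gt0 (dvdn_trans _ p2d) ?dvdn_exp // => /(_ isT).
by move: p2d; rewrite pfactor_dvdn // => /[swap] /eqP ->.
Qed.

(** Divisors divisible by p^2 contribute nothing; the others pair off as d and p d with p not
    dividing d, where [mobius] has opposite signs and [h] agrees. *)
Lemma sum_mobius_eq0 (R : pzRingType) p n (h : nat -> R) :
  prime p -> (0 < n)%N -> (p %| n)%N ->
  (forall d, (d %| n)%N -> ~~ (p %| d)%N -> h (p * d)%N = h d) ->
  \sum_(d <- divisors n) (mobius d)%:~R * h d = 0.
Proof.
move=> p_pr n_gt0 p_n hE; have p_gt0 := prime_gt0 p_pr.
have divE d : (d \in divisors n) = (d %| n)%N by rewrite dvdn_divisors.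
rewrite (bigID (fun d => ~~ (p %| d)%N)) /=.
rewrite [X in _ + X](bigID (fun d => ~~ (p ^ 2 %| d)%N)) /=.
rewrite [X in _ + (_ + X)]big_seq_cond.
rewrite [X in _ + (_ + X)]big1 => [|d]; last first.
  rewrite divE => /and3P[d_n _ /negPn p2d].
  by rewrite (mobius_sqr p_pr) ?mul0r // (dvdn_gt0 n_gt0).
rewrite addr0 -[X in _ + X]big_filter.
(* The divisors with exactly one factor p are the p d, for d a divisor prime to p. *)
rewrite [X in _ + X](perm_big
  [seq (p * d)%N | d <- divisors n & ~~ (p %| d)%N]) /=; last first.
  apply: uniq_perm; rewrite ?filter_uniq ?divisors_uniq //.
    rewrite map_inj_uniq ?filter_uniq ?divisors_uniq // => i j /eqP.
    by rewrite eqn_pmul2l // => /eqP.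
  move=> d; rewrite mem_filter negbK divE.
  apply/idP/mapP => [/andP[/andP[/dvdnP[e ->] p2] pd_n] | [e]].
    exists e; last by rewrite mulnC.
    rewrite mem_filter divE (dvdn_trans _ pd_n) ?dvdn_mulr // andbT.
    by move: p2; rewrite mulnC expnS expn1 dvdn_pmul2l.
  rewrite mem_filter divE => /andP[pNe e_n] ->.
  rewrite dvdn_mulr // expnS expn1 dvdn_pmul2l // pNe Gauss_dvd ?p_n //.
  by rewrite prime_coprime.
rewrite big_map big_filter -big_split /= big_seq_cond big1 // => d /andP[].
rewrite divE => d_n pNd.
by rewrite hE // mobius_mul_prime ?(dvdn_gt0 n_gt0) // rmorphN mulNr addrN.
Qed.

(** * Divisibility by [n]_q tested at roots of unity *)

Lemma poly_divides_qint n r : (0 < n)%N ->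
  (forall w, w ^+ n = 1 -> w != 1 -> ev w r = 0) -> poly_divides (qint n) r.
Proof.
case: n => // n _ r0; exists (r %/ qint n.+1).
have mq := qint_monic n.
rewrite [LHS](Pdiv.IdomainMonic.divp_eq mq); set s := _ %% _.
(* With n now lowered by one, [qint n.+1] has degree n. The remainder [s] has smaller degree but
   vanishes at the n distinct numbers z, ..., z^n, where z is a primitive root of order n + 1. *)
suff -> : s = 0 by rewrite addr0.
have size_q : size (qint n.+1) = n.+1.
  have := congr1 (fun p : {poly int} => size p) (qintM n.+1).
  rewrite -!polyC1 /= size_Mmonic ?monic_neq0 ?monicXsubC //.
  by rewrite size_XsubC size_XnsubC // addn2 => -[].
have lt_s : (size s < n.+1)%N by rewrite -size_q ltn_modp monic_neq0.
have [z zn] := C_prim_root_exists (ltn0Sn n).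
apply/eqP; apply: contraTT lt_s => s_neq0; rewrite -leqNgt.
have rs_uniq : uniq [seq z ^+ i | i <- iota 1 n].
  rewrite map_inj_in_uniq ?iota_uniq // => i j; rewrite !mem_iota.
  case/andP=> _ lt_i /andP[_ lt_j] /eqP.
  by rewrite (eq_prim_root_expr zn) !modn_small // => /eqP.
have sz : size (map_poly (intr : int -> algC) s) = size s.
  by apply: size_map_inj_poly => //; exact: intr_inj.
have := @max_poly_roots _ (map_poly intr s) [seq z ^+ i | i <- iota 1 n].
rewrite sz size_map size_iota => -> //.
  by rewrite -size_poly_eq0 sz size_poly_eq0.
apply/allP => _ /mapP[i + ->]; rewrite mem_iota => /andP[i_gt0 i_lt].
have zi1 : (z ^+ i) ^+ n.+1 = 1 by rewrite exprAC (prim_expr_order zn) expr1n.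
have ziN1 : z ^+ i != 1 by rewrite -(prim_order_dvd zn) gtnNdvd.
have := r0 _ zi1 ziN1.
rewrite {1}(Pdiv.IdomainMonic.divp_eq mq r) rmorphD rmorphM /=.
suff -> : ev (z ^+ i) (qint n.+1) = 0 by rewrite mulr0 add0r => /eqP.
have /(congr1 (ev (z ^+ i))) := qintM n.+1.
rewrite rmorphM !rmorphB rmorph1 /= -['X]expr1 !evX zi1 subrr => /eqP.
by rewrite mulf_eq0 expr1 subr_eq0 (negPf ziN1) orbF => /eqP.
Qed.

(** The hypothesis ranges over all orders m, including 1, because it is applied to the powers
    [w ^+ d], whose order may drop. *)
Lemma q_Gauss_root a (c : nat -> algC) :
  (forall m N w, (0 < N)%N -> m.-primitive_root w ->
    ev w (a (m * N)%N) = c N) ->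
  q_Gauss a.
Proof.
move=> aE n n_gt0; apply: poly_divides_qint => // w wn w_neq1.
have [m wm m_n] := prim_order_exists n_gt0 wn.
have m_gt0 := prim_order_gt0 wm.
have m_gt1 : (1 < m)%N.
  case: m wm {m_n} m_gt0 => [|[|m]] // /prim_expr_order.
  by rewrite expr1 => w1; rewrite w1 eqxx in w_neq1.
have p_pr := pdiv_prime m_gt1; have p_m := pdiv_dvd m.
rewrite rmorph_sum /=.
pose h d := c (n %/ lcmn m d)%N.
rewrite -[RHS](@sum_mobius_eq0 algC (pdiv m) n h) ?(dvdn_trans p_m) //.
  rewrite !big_seq; apply: eq_bigr => d; rewrite -dvdn_divisors // => d_n.
  rewrite -[X in X *: _]intz scaler_int rmorphMz /= ev_comp mulrzl.
  congr (_ *~ _).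
  have /dvdnP[t def_n] : (lcmn m d %| n)%N by rewrite dvdn_lcm m_n.
  have lcm_gt0 : (0 < lcmn m d)%N by rewrite lcmn_gt0 m_gt0 (dvdn_gt0 n_gt0).
  have t_gt0 : (0 < t)%N by move: n_gt0; rewrite def_n muln_gt0 => /andP[].
  (* The order of [w ^+ d] is m / gcd(d, m); the index n / d is that order times t = n / lcm(m,
     d). *)
  have def_nd : (n %/ d = m %/ gcdn d m * t)%N.
    rewrite def_n /lcmn -(@divn_mulAC (gcdn m d) m d) ?dvdn_gcdl //.
    by rewrite mulnA mulnK ?(dvdn_gt0 n_gt0) // gcdnC mulnC.
  rewrite def_nd (aE _ _ _ t_gt0 (exp_prim_root wm d)) /h def_n mulnK //.
move=> d d_n pNd; rewrite /h; congr (c (_ %/ _)%N).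
have /dvdnP[m' def_m] := p_m.
(* Written as an lcm, the product p d lets p be absorbed into m by associativity. *)
have <- : lcmn (pdiv m) d = (pdiv m * d)%N.
  have : coprime (pdiv m) d by rewrite prime_coprime.
  by rewrite /lcmn => /eqP->; rewrite divn1.
by rewrite lcmnA (_ : lcmn m (pdiv m) = m) // lcmnC {2}def_m lcmnMr -def_m.
Qed.

(** * Gaussian binomials and the q-Lucas congruence *)

Lemma qbinn n : qbin n n = 1.
Proof.
have := @qbinE n n (leqnn n).
rewrite subnn {2}/qfact big_geq // mulr1 -[RHS]mul1r => /mulIf; apply.
exact/monic_neq0/qfact_monic.
Qed.

Lemma qbin0 n : qbin n 0 = 1.
Proof.
have := @qbinE n 0 (leq0n n).
rewrite subn0 {1}/qfact big_geq // mul1r -[RHS]mul1r => /mulIf; apply.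
exact/monic_neq0/qfact_monic.
Qed.

(** The q-Pascal rule: clear denominators and split [n+1] as [k+1] + q^(k+1) [n-k]. *)
Lemma qbinS n k : (k < n)%N ->
  qbin n.+1 k.+1 = qbin n k + 'X^(k.+1) * qbin n k.+1.
Proof.
move=> lt_kn; have nz : qfact k.+1 * qfact (n - k) != 0.
  by apply/monic_neq0; rewrite monicMl; exact: qfact_monic.
apply: (mulIf nz).
have := @qbinE n.+1 k.+1 (ltnW lt_kn); rewrite subSS => ->.
rewrite qfactS.
have -> : qint n.+1 = qint k.+1 + 'X^(k.+1) * qint (n - k).
  by rewrite -qintD; congr qint; lia.
rewrite mulrDr -{1}(@qbinE n k) ?(ltnW lt_kn) // -(@qbinE n k.+1) //.
have -> : qfact (n - k) = qfact (n - k.+1) * qint (n - k).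
  by rewrite (_ : (n - k = (n - k.+1).+1)%N) ?qfactS //; lia.
rewrite qfactS; ring.
Qed.

(** The q-binomial theorem, by induction on n: multiplying by X - w^n reproduces the q-Pascal
    rule. *)
Lemma coef_prod_qXsubC (w : algC) n k : (k <= n)%N ->
  (\prod_(0 <= i < n) ('X - (w ^+ i)%:P))`_k =
  (-1) ^+ (n - k) * w ^+ 'C(n - k, 2) * ev w (qbin n k).
Proof.
elim: n k => [|n IHn] k.
  by case: k => // _; rewrite big_geq // qbin0 rmorph1 coef1 !mul1r.
rewrite big_nat_recr //= mulrBr coefB coefMC coefMX.
case: k => [_|k]; rewrite /= ?ltnS.
  rewrite IHn // !qbin0 rmorph1 !subn0 binS bin1 exprS exprD; ring.
(* The top coefficient lies outside the range of [qbinS]; there the second term is a coefficient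
   beyond the degree, hence 0. *)
rewrite leq_eqVlt => /predU1P[-> | lt_kn].
  rewrite IHn // !subnn !qbinn [X in _ - X * _]nth_default ?mul0r ?subr0 //.
  by rewrite size_prod_XsubC size_iota subn0.
rewrite !IHn //; last exact: ltnW.
rewrite subSS qbinS // rmorphD rmorphM /= evX.
have [t ->] : exists t, n = (t + k.+1)%N by exists (n - k.+1)%N; lia.
rewrite addnK addnS -addSn addnK binS bin1 addSn -addnS exprS !exprD; ring.
Qed.

(** Compares two expressions for the coefficient of X^k in (X^m - 1)^N: the q-binomial theorem and
    the ordinary binomial expansion. *)
Lemma qLucas m N (w : algC) k : m.-primitive_root w -> (k <= m * N)%N ->
  ev w (qbin (m * N) k) = (if (m %| k)%N then 'C(N, (k %/ m)%N)%:R else 0).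
Proof.
move=> wm.
have m_gt0 := prim_order_gt0 wm.
have w_neq0 : w != 0.
  have := prim_expr_order wm; apply: contra_eq_neq => ->.
  by rewrite expr0n gtn_eqF // eq_sym oner_eq0.
have prodE M : \prod_(0 <= i < m * M) ('X - (w ^+ i)%:P) = ('X^m - 1) ^+ M.
  elim: M => [|M IHM]; first by rewrite muln0 big_geq.
  rewrite mulnS addnC (@big_cat_nat _ _ _ (m * M)) ?leq_addr //= IHM exprSr.
  congr (_ * _); rewrite -(factor_Xn_sub_1 wm).
  rewrite -{1}[(m * M)%N]add0n big_addn addKn.
  apply: eq_bigr => i _.
  by rewrite exprD exprM (prim_expr_order wm) expr1n mulr1.
have coefE M j : ((('X^m - 1) ^+ M)`_j : algC) =
    if (m %| j)%N then (-1) ^+ (M - (j %/ m)%N) * 'C(M, (j %/ m)%N)%:R else 0.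
  have -> : ('X^m - 1) ^+ M = (('X - 1) ^+ M) \Po 'X^m :> {poly algC}.
    by rewrite rmorphXn rmorphB rmorph1 /= comp_polyX.
  rewrite coef_comp_poly_Xn //; case: ifP => // _; set i := (j %/ m)%N.
  rewrite addrC exprDn coef_sum.
  under eq_bigr => l _.
    rewrite -polyC1 -polyCN -polyC_exp coefMn coefCM coefXn.
    over.
  have [lt_iM | le_Mi] := ltnP i M.+1.
    rewrite (bigD1 (Ordinal lt_iM)) //= eqxx mulr1.
    rewrite big1 ?addr0 ?mulr_natr // => l.
    by rewrite -val_eqE /= eq_sym => /negPf->; rewrite mulr0 mul0rn.
  rewrite big1 ?bin_small ?mulr0 // => l _.
  by rewrite gtn_eqF ?mulr0 ?mul0rn // (leq_trans _ le_Mi).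
move=> le_k.
have u_neq0 j : (-1) ^+ j * w ^+ 'C(j, 2) != 0.
  by rewrite mulf_neq0 ?expf_neq0 ?oppr_eq0 ?oner_eq0.
have := coef_prod_qXsubC w le_k; rewrite prodE coefE.
case: ifP => [/dvdnP[j def_k] | _]; last first.
  by move/esym/eqP; rewrite mulf_eq0 (negPf (u_neq0 _)) => /eqP.
rewrite {k}def_k mulnC leq_pmul2l // in le_k *.
rewrite mulKn // -mulnBr.
(* The sign and power of w are those of the constant coefficient of
   (X^m - 1)^(N - j), so they need not be computed. *)
have := coef_prod_qXsubC w (leq0n (m * (N - j))).
rewrite prodE coefE dvdn0 div0n bin0 qbin0 [ev w 1]rmorph1 !subn0 !mulr1 => ->.
by move=> /(mulfI (u_neq0 _))->.
Qed.

(** * The sequence d_n; its values at roots of unity are central trinomial coefficients *)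

Definition dcount N : algC :=
  \sum_(0 <= j < (N./2).+1) ('C(N, j) * 'C(N - j, j))%N%:R.

Lemma ev_d_seq b m N w : m.-primitive_root w ->
  ev w (d_seq b (m * N)) = dcount N.
Proof.
move=> wm; have m_gt0 := prim_order_gt0 wm.
rewrite /d_seq rmorph_sum /=.
transitivity (\sum_(0 <= i < ((m * N)./2).+1 | (m %| i)%N)
    ('C(N, (i %/ m)%N) * 'C(N - i %/ m, i %/ m))%N%:R : algC).
  rewrite [RHS]big_mkcond; apply: eq_big_nat => i /andP[_ le_i].
  rewrite !rmorphM /= evX (qLucas wm); last by lia.
  (* Only i = m j survives. The second upper index is then m (N - j), so q-Lucas applies again, and
     the power of w is 1 because its exponent is a multiple of i. *)
  case: ifP => [/dvdnP[j def_i] | _]; last by rewrite mulr0 mul0r.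
  rewrite {i}def_i mulnK // [(m * N - _)%N](_ : _ = (m * (N - j))%N) in le_i *.
    rewrite (qLucas wm); last by nia.
    rewrite dvdn_mull // mulnK // abszM.
    suff -> : w ^+ (`|(j * m)%N%:Z| * `|(j * m)%N%:Z + b|) = 1 by rewrite mul1r.
    by apply/eqP; rewrite -(prim_order_dvd wm) dvdn_mulr // absz_nat dvdn_mull.
  by rewrite mulnBr [(j * m)%N]mulnC.
rewrite /dcount -big_filter.
rewrite (perm_big [seq (m * j)%N | j <- index_iota 0 (N./2).+1]); last first.
  apply: uniq_perm; first by rewrite filter_uniq // iota_uniq.
    rewrite map_inj_uniq ?iota_uniq // => i j /eqP.
    by rewrite eqn_pmul2l // => /eqP.
  move=> i; rewrite mem_filter mem_index_iota leq0n andTb.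
  apply/idP/mapP => [/andP[/dvdnP[j ->] lt_i] | [j]].
    by exists j; rewrite 1?mulnC // mem_index_iota /=; nia.
  rewrite mem_index_iota /= => lt_j ->; rewrite dvdn_mulr //=; nia.
by rewrite big_map; apply: eq_bigr => j _; rewrite mulKn.
Qed.

(** * Products of the matrices A(q^i x): traces, determinants and degrees *)

Section Transfer.
Variable R : comNzRingType.
Implicit Types (q x : R) (M : 'M[R]_2).

(* A_mx over an arbitrary ring, convertible to it over {poly int}. *)
Definition step x : 'M[R]_2 :=
  \matrix_(i < 2, j < 2)
    if i == 0 then (if j == 0 then 1 else x) else (if j == 0 then 1 else 0).

(* transfer q x n is A(q^(n-1) x) ... A(q x) A(x). *)
Fixpoint transfer q x n : 'M[R]_2 :=
  if n is n'.+1 then step (q ^+ n' * x) * transfer q x n' else 1.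

Lemma transferD q x m n :
  transfer q x (m + n) = transfer q (q ^+ n * x) m * transfer q x n.
Proof.
elim: m => [|m IHm] /=; first by rewrite mul1r.
by rewrite IHm mulrA mulrA exprD.
Qed.

Lemma transferX q m N : q ^+ m = 1 ->
  transfer q 1 (m * N) = transfer q 1 m ^+ N.
Proof.
move=> qm; elim: N => [|N IHN]; first by rewrite muln0.
by rewrite mulnS transferD IHN exprM qm expr1n mul1r -exprS.
Qed.

Lemma transfer_prod q n :
  transfer q 1 n = \prod_(0 <= i < n) step (q ^+ (n.-1 - i)).
Proof.
elim: n => [|n IHn]; first by rewrite big_geq.
rewrite big_nat_recl //= subn0 mulr1 IHn; congr (_ * _).
by apply: eq_big_nat => i lt_i; congr (step (q ^+ _)); lia.
Qed.

(** The leftmost factor on the left-hand side is A(q^m x) = A(x); cyclicity of the trace moves it to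
    the right end. *)
Lemma mxtrace_transfer_rot q x m : q ^+ m = 1 ->
  \tr (transfer q (q * x) m) = \tr (transfer q x m).
Proof.
case: m => // m qm; have := transferD q x m 1; rewrite addn1 => -> /=.
rewrite !expr1 expr0 mulr1 !mul1r.
by rewrite mulrA -exprSr qm mul1r [LHS]mxtrace_mulC.
Qed.

Lemma det_transfer q x n :
  \det (transfer q x n) = \prod_(0 <= i < n) - (q ^+ i * x).
Proof.
elim: n => [|n IHn]; first by rewrite det1 big_geq.
rewrite big_nat_recr //= det_mulmx IHn mulrC; congr (_ * _).
rewrite (expand_det_row _ 0) !big_ord_recl big_ord0 /cofactor !det_mx11 !mxE /=.
ring.
Qed.

(** [step 0] is idempotent. *)
Lemma transfer0 q n : transfer q 0 n.+1 = step 0.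
Proof.
elim: n => [|n IHn]; first by rewrite /= !mulr0 mulr1.
have -> : transfer q 0 n.+2 = step (q ^+ n.+1 * 0) * transfer q 0 n.+1 by [].
rewrite IHn mulr0.
apply/matrixP=> i j; rewrite !mxE !big_ord_recl big_ord0 !mxE /=.
by case: i j => [[|[|]]] //= ? [[|[|]]] //= ?; ring.
Qed.

Lemma mxtrace_exp_fib M n : \det M = -1 ->
  \tr (M ^+ n.+2) = \tr M * \tr (M ^+ n.+1) + \tr (M ^+ n).
Proof.
move=> detM; rewrite !exprS mulrA.
(* Cayley-Hamilton for determinant -1, checked entry by entry. *)
have -> : M * M = \tr M *: M + 1%:M.
  have lift01 : lift ord0 ord0 = 1 :> 'I_2 by exact/val_inj.
  move: detM; rewrite (expand_det_row _ 0) !big_ord_recl big_ord0.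
  rewrite /cofactor !det_mx11.
  rewrite !mxE /mxtrace !big_ord_recl !big_ord0 !lift01 /=.
  rewrite (_ : lift 1 0 = 0 :> 'I_2); last exact/val_inj.
  move=> detM; have E1 : 1 = M 0 1 * M 1 0 - M 0 0 * M 1 1.
    by rewrite -[LHS]opprK -detM /=; ring.
  have ord2 (i : 'I_2) : i = 0 \/ i = 1.
    by case: i => [[|[|]]] // ?; [left | right]; exact: val_inj.
  apply/matrixP=> i j; rewrite !mxE !big_ord_recl big_ord0 !lift01.
  case: (ord2 i) (ord2 j) => [->|->] [->|->];
    by rewrite /= ?mulr1n ?mulr0n ?E1; ring.
by rewrite mulrDl mul1r mxtraceD -scalerAl mxtraceZ.
Qed.
End Transfer.

Lemma map_transfer (R S : comNzRingType) (f : {rmorphism R -> S}) q x n :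
  map_mx f (transfer q x n) = transfer (f q) (f x) n.
Proof.
elim: n => [|n IHn] /=; first by rewrite map_mx1.
rewrite map_mxM IHn; congr (_ * _); apply/matrixP=> i j; rewrite !mxE.
by rewrite -rmorphXn -rmorphM; do 2?case: ifP; rewrite ?rmorph1 ?rmorph0.
Qed.

Lemma coef_comp_scaleX (R : comNzRingType) (p : {poly R}) (a : R) i :
  (p \Po (a *: 'X))`_i = p`_i * a ^+ i.
Proof.
rewrite coef_comp_poly.
under eq_bigr => j _ do rewrite exprZn coefZ coefXn.
have [lt_i | le_i] := ltnP i (size p).
  rewrite (bigD1 (Ordinal lt_i)) //= eqxx mulr1 big1 ?addr0 // => j.
  by rewrite -val_eqE /= eq_sym => /negPf->; rewrite !mulr0.
rewrite nth_default // mul0r big1 // => j _.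
by rewrite gtn_eqF ?mulr0 // (leq_trans _ le_i).
Qed.

(** Each new factor turns the rows r0, r1 into r0 + w^n x r1 and r0, so the degree grows only every
    other step. Merely counting factors would bound it by n, too weak to rule out the coefficient of
    x^m in the trace for n = m. *)
Lemma size_transfer (F : fieldType) (w : F) n (j : 'I_2) :
  (size (transfer w%:P 'X n (0 : 'I_2)%R j) <= (uphalf n).+1)%N /\
  (size (transfer w%:P 'X n (1 : 'I_2)%R j) <= (n./2).+1)%N.
Proof.
elim: n => [|n [IH0 IH1]].
  by rewrite !mxE; split; case: (_ == _); rewrite ?size_poly1 ?size_poly0.
rewrite /= !mxE !big_ord_recl !big_ord0 !mxE /= !mul1r mul0r !addr0.
rewrite (_ : lift ord0 ord0 = 1) //; last exact/val_inj.
split=> //; apply: leq_trans (size_polyD _ _) _; rewrite geq_max.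
apply/andP; split; first by apply: leq_trans IH0 _; lia.
apply: leq_trans (size_polyMleq _ _) _.
rewrite -polyC_exp mul_polyC.
have size_wX : (size ((w ^+ n) *: 'X : {poly F}) <= 2)%N.
  by apply: leq_trans (size_scale_leq _ _) _; rewrite size_polyX.
by have := leq_add size_wX IH1; case: (_ + _)%N.
Qed.

Lemma mxtrace_transfer_root (F : fieldType) m (w : F) :
  m.-primitive_root w -> \tr (transfer w 1 m) = 1.
Proof.
move=> wm; have m_gt0 := prim_order_gt0 wm.
have wm1 := prim_expr_order wm.
have tr_step (R : comNzRingType) (x : R) : \tr (step x) = 1.
  by rewrite /mxtrace !big_ord_recl big_ord0 !mxE /= !addr0.
(* For m = 1 the size bound would still allow degree m, so the trace is read off directly. *)
case: m => [|[|m]] // in wm m_gt0 wm1 *; first by rewrite /= mulr1 tr_step.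
pose T := \tr (transfer w%:P 'X m.+2).
have T_at a : T.[a] = \tr (transfer w a m.+2).
  rewrite -[LHS]/(horner_eval a T) /T -trace_map_mx map_transfer /=.
  by rewrite /horner_eval hornerC hornerX.
have size_T : (size T <= m.+2)%N.
  rewrite /T /mxtrace !big_ord_recl big_ord0 addr0.
  rewrite (_ : lift ord0 ord0 = 1); last exact/val_inj.
  apply: leq_trans (size_polyD _ _) _; rewrite geq_max.
  have [le0 _] := size_transfer w m.+2 0.
  have [_ le1] := size_transfer w m.+2 1.
  by rewrite (leq_trans le0) ?(leq_trans le1) //; lia.
have T_rot : T \Po (w *: 'X) = T.
  rewrite -[RHS](@mxtrace_transfer_rot _ w%:P); last by rewrite -polyC_exp wm1.
  rewrite /T -[LHS]/(comp_poly (w *: 'X) _) -trace_map_mx map_transfer /=.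
  by rewrite comp_polyC comp_polyX mul_polyC.
(* Invariance gives T_i w^i = T_i, and w^i differs from 1 for 0 < i < m, the order of w. *)
have T_const : T = (T`_0)%:P.
  apply/polyP=> i; rewrite coefC; case: eqP => [-> // | /eqP i_neq0].
  have [lt_i | le_i] := ltnP i m.+2; last first.
    by rewrite nth_default // (leq_trans size_T).
  apply/eqP; have /eqP := congr1 (fun p : {poly F} => p`_i) T_rot.
  rewrite /= coef_comp_scaleX -{2}[T`_i]mulr1 -subr_eq0 -mulrBr.
  rewrite mulf_eq0 subr_eq0.
  by rewrite -(prim_order_dvd wm) gtnNdvd ?lt0n // orbF.
by rewrite -T_at T_const hornerC -horner_coef0 T_at transfer0 tr_step.
Qed.

(** * The sequence e_n; its values at roots of unity are Lucas numbers *)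

Definition etrace N : algC := \tr (step 1 ^+ N).

Lemma ev_e_seq m N w : m.-primitive_root w -> ev w (e_seq (m * N)) = etrace N.
Proof.
move=> wm.
have -> : e_seq (m * N) = \tr (transfer 'X 1 (m * N)) by rewrite transfer_prod.
have wX : ev w 'X = w by rewrite -['X]expr1 evX.
rewrite -trace_map_mx map_transfer rmorph1 /= wX.
rewrite transferX ?(prim_expr_order wm) //.
pose M := transfer w 1 m.
have trM : \tr M = 1 by apply: mxtrace_transfer_root.
have detM : \det M = -1.
  rewrite det_transfer.
  (* The product of the -w^i is X^m - 1 at X = 0, which gives -1 whatever the parity of m. *)
  have /(congr1 (horner_eval 0)) := factor_Xn_sub_1 wm.
  rewrite rmorph_prod rmorphB /= /horner_eval !hornerE expr0n.
  rewrite gtn_eqF ?sub0r ?(prim_order_gt0 wm) // => <-.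
  by apply: eq_bigr => i _; rewrite !hornerE ?add0r.
have det1 : \det (step (1 : algC)) = -1.
  by have := det_transfer (1 : algC) 1 1; rewrite /= big_nat1 !mulr1.
have tr1 : \tr (step (1 : algC)) = 1.
  by rewrite /mxtrace !big_ord_recl big_ord0 !mxE /= !addr0.
rewrite /etrace -/M.
(* Both trace sequences obey the same two-term recurrence, so two consecutive values are carried
   through the induction. *)
suff: \tr (M ^+ N) = \tr (step 1 ^+ N) /\
      \tr (M ^+ N.+1) = \tr (step 1 ^+ N.+1) by case.
elim: N => [|N [IH0 IH1]]; first by rewrite !expr0 !expr1 trM tr1.
by split=> //; rewrite !mxtrace_exp_fib // IH0 IH1 trM tr1.
Qed.

Theorem theorem1p1 :
  (forall b : int, -1 <= b -> q_Gauss (d_seq b)) /\ q_Gauss e_seq.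
Proof.
split=> [b _|].
  by apply: (@q_Gauss_root _ dcount) => m N w _; exact: ev_d_seq.
by apply: (@q_Gauss_root _ etrace) => m N w _; exact: ev_e_seq.
Qed.
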